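(* Let $\Gamma$ be a group with two $\mathcal A$-bipartite $\Gamma$-trees $T,T'$ such that $\Gamma$ is a piecewise trivial suspension over $T$ and over $T'$. Then there is an isomorphism of $\Gamma$-trees $f:T\to T'$ (a $\Gamma$-equivariant simplicial isomorphism).
   Context: $\mathcal A$ denotes the collection of abelian subgroups of $\Gamma$. An $\mathcal A$-bipartite $\Gamma$-tree is a simplicial tree with an action of $\Gamma$ without edge inversion, with vertices coloured black and white (adjacent vertices having different colours, the action preserving colours) and abelian edge stabilizers. $\Gamma$ is a piecewise trivial suspension over $T$ if: (1) black vertex stabilizers and edge stabilizers are free abelian of rank $2$; (2) for every white vertex $v$, the stabilizer $\Gamma_v$ is a direct product $G_v\times\langle t_v\rangle$ of a subgroup $G_v$ of $\Gamma$ with trivial centre and an infinite cyclic subgroup $\langle t_v\rangle$; (3) for every white vertex $v$, the element $t_v$ and its non-trivial powers fix exactly the ball of radius $2$ around $v$.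
   Formalization: Both trees are assumed to have no vertex of valence one (true of minimal trees). Without this the claim fails: for D∞×Z, a single white vertex and a white vertex with two black leaves swapped by the reflections both satisfy the hypotheses but are not isomorphic. *)

(* Defs.v *)
From mathcomp Require Import all_boot all_algebra.
From mathcomp Require Import boolp classical_sets.

Set Implicit Arguments.
Unset Strict Implicit.
Unset Printing Implicit Defensive.

Local Open Scope classical_set_scope.
Local Open Scope group_scope.

Section Groups.
Variable Gamma : groupType.
Implicit Types (t : Gamma) (H K : set Gamma).

(* The monoid library has powers with exponent in nat only. *)
Definition zpow t (n : int) : Gamma :=
  match n with Posz k => t ^+ k | Negz k => t ^- k.+1 end.

Definition cyclic_subgroup t : set Gamma := range (zpow t).

Definition infinite_order t : Prop := forall k : nat, 0 < k -> t ^+ k <> 1.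

Definition is_subgroup H : Prop := group_closed [in H].

Definition is_abelian H : Prop := forall g h, H g -> H h -> commute g h.

Definition center H : set Gamma :=
  [set g | H g /\ forall h, H h -> commute g h].

Definition is_direct_product (L H K : set Gamma) : Prop :=
  [/\ is_subgroup H,
      is_subgroup K,
      forall h k, H h -> K k -> commute h k,
      H `&` K = [set 1]
    & [set h * k | h in H & k in K] = L].

(* H is isomorphic to the additive group Z^n. *)
Definition free_abelian_of_rank (n : nat) H : Prop :=
  exists phi : 'rV[int]_n -> Gamma,
    [/\ {morph phi : u v / (u + v)%R >-> u * v},
        injective phi
      & range phi = H].

End Groups.

Section Graphs.
Variable V : choiceType.
Implicit Types (adj : rel V) (x y : V).

Definition ball adj x (r : nat) : set V :=
  [set y | exists p : seq V, [/\ path adj x p, last x p = y & size p <= r]].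

(* On a simple graph the sequences c of size 2 with ucycle adj c are the
   edges, so that the circuits are those of size at least 3. *)
Definition is_tree adj : Prop :=
  [/\ inhabited V,
      symmetric adj,
      irreflexive adj,
      forall x y, exists p : seq V, path adj x p /\ last x p = y
    & forall c : seq V, 2 < size c -> ~ ucycle adj c].

End Graphs.

(* A-bipartite Gamma-trees, where A is the class of abelian subgroups of Gamma;
   a simplicial tree is given by its vertices and their adjacency relation, and
   the black vertices are those that are not white. As there is no inversion,
   the stabilizer of an edge is the pointwise stabilizer of its endpoints. *)
Record bipartite_tree (Gamma : groupType) := BipartiteTree {
  vertex :> choiceType;
  adj : rel vertex;
  white : pred vertex;
  act : Gamma -> vertex -> vertex;
  adj_tree : is_tree adj;
  act1 : forall x, act 1 x = x;
  actM : forall g h x, act (g * h) x = act g (act h x);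
  act_adj : forall g x y, adj (act g x) (act g y) = adj x y;
  act_no_inversion :
    forall g x y, adj x y -> ~ (act g x = y /\ act g y = x);
  adj_white : forall x y, adj x y -> white x != white y;
  act_white : forall g x, white (act g x) = white x;
  edge_abelian :
    forall x y, adj x y -> is_abelian [set g | act g x = x /\ act g y = y]
}.

Section BipartiteTrees.
Variables (Gamma : groupType) (T : bipartite_tree Gamma).
Implicit Types x y : T.

Definition vertex_stab x : set Gamma := [set g | act g x = x].

Definition edge_stab x y : set Gamma := vertex_stab x `&` vertex_stab y.

Definition fixed_points (g : Gamma) : set T := [set x | act g x = x].

(* No vertex has valence one. Every minimal Gamma-tree of this kind has this
   property: neighbours of a leaf have the other colour, so removing the orbit
   of a leaf leaves a nonempty invariant subtree. Some such convention is needed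
   to compare trees: attaching an orbit of black leaves to a white vertex can
   turn a tree over which Gamma is a piecewise trivial suspension into another,
   non-isomorphic one. *)
Definition leafless : Prop :=
  forall x y, adj x y -> exists2 z : T, adj x z & z <> y.

Definition piecewise_trivial_suspension : Prop :=
  [/\ forall x, ~~ white x -> free_abelian_of_rank 2 (vertex_stab x),
      forall x y, adj x y -> free_abelian_of_rank 2 (edge_stab x y)
    & forall v, white v ->
        exists (G : set Gamma) (t : Gamma),
          [/\ is_direct_product (vertex_stab v) G (cyclic_subgroup t),
              center G = [set 1],
              infinite_order t
            & forall n : int, n <> 0%R ->
                fixed_points (zpow t n) = ball (@adj _ T) v 2]].

End BipartiteTrees.

Definition is_Gamma_tree_isomorphism (Gamma : groupType)
    (T T' : bipartite_tree Gamma) (f : T -> T') : Prop :=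
  [/\ bijective f,
      forall x y, adj (f x) (f y) = adj x y
    & forall g x, f (act g x) = act g (f x)].

(* Main.v *)
Require Import Defs.
From mathcomp Require Import all_boot all_algebra.
From mathcomp Require Import boolp classical_sets.
From mathcomp Require Import zify ring.

(* When Gamma is not abelian, the tree is recovered from the subgroup structure
   of Gamma. A white stabilizer is the centralizer of its element t_v, it is not
   abelian, and its centre is <t_v>. Conversely, an element g <> 1 whose
   centralizer C(g) is not abelian and has centre <g> is t_v or its inverse for
   some white v: a fixed point of g yields a vertex fixed by C(g), and the
   centralizer of an element without fixed point is abelian; that vertex is a
   white v, as black stabilizers are abelian; then t_v is central in C(g), so
   that t_v is a power of g. Black stabilizers are the intersections of two
   distinct white stabilizers such that t_v1 fixes v2. Stabilizers determine
   vertices and adjacency amounts to inclusion of stabilizers, so the isomorphism sends a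
   vertex of T to the vertex of T' with the same stabilizer. When Gamma is
   abelian both trees are reduced to a vertex. *)

Set Implicit Arguments.
Unset Strict Implicit.
Unset Printing Implicit Defensive.

Local Open Scope classical_set_scope.
Local Open Scope group_scope.

(** * Integer powers, centralizers and free abelian groups *)

Section Groups.
Variable Gamma : groupType.
Implicit Types (g h t : Gamma) (n m : int).

Lemma zpow0 t : zpow t 0%R = 1.
Proof. by []. Qed.

Lemma zpow1 t : zpow t 1%R = t.
Proof. exact: expg1. Qed.

Lemma zpowS t n : zpow t (n + 1)%R = zpow t n * t.
Proof.
case: n => [n|[|n]].
- rewrite (_ : (Posz n + 1 = Posz n.+1)%R); last by lia.
  by rewrite /zpow expgSr.
- have -> : (Negz 0 + 1 = 0)%R by lia.
  by rewrite zpow0 /zpow expg1 mulVg.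
- have -> : (Negz n.+1 + 1 = Negz n)%R by lia.
  by rewrite /zpow (expgS t n.+1) invgM -mulgA mulVg mulg1.
Qed.

Lemma zpowD t n m : zpow t (n + m)%R = zpow t n * zpow t m.
Proof.
elim/int_rect: m => [|m IH|m IH]; first by rewrite GRing.addr0 zpow0 mulg1.
- have -> : (n + m.+1%:Z = (n + m%:Z) + 1)%R by lia.
  have -> : (m.+1%:Z = m%:Z + 1)%R by lia.
  by rewrite !zpowS IH mulgA.
- have e : (- m%:Z = - m.+1%:Z + 1)%R by lia.
  move: IH; rewrite e GRing.addrA !zpowS mulgA.
  exact: mulIg.
Qed.

Lemma zpowM t n m : zpow (zpow t n) m = zpow t (n * m)%R.
Proof.
elim/int_rect: m => [|m IH|m IH]; first by rewrite GRing.mulr0.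
- have -> : (n * m.+1%:Z = n * m%:Z + n)%R by lia.
  have -> : (m.+1%:Z = m%:Z + 1)%R by lia.
  by rewrite zpowS zpowD IH.
- have e : (- m%:Z = - m.+1%:Z + 1)%R by lia.
  have e' : (n * - m%:Z = n * - m.+1%:Z + n)%R by lia.
  by move: IH; rewrite e' e zpowS zpowD; exact: mulIg.
Qed.

Lemma commute_zpow g h n : commute g h -> commute g (zpow h n).
Proof.
by case: n => n gh /=; [exact: commuteX | apply/commuteV/commuteX].
Qed.

Lemma zpow_mul g h n : commute g h -> zpow (g * h) n = zpow g n * zpow h n.
Proof.
move=> gh; case: n => n /=; rewrite expgMn// invgM.
apply/commuteV/commute_sym/commuteV/commuteX/commute_sym; exact: commuteX.
Qed.

Lemma zpow_eq1 t n : infinite_order t -> zpow t n = 1 -> n = 0%R.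
Proof.
move=> inf; case: n => [[|n]|n] //= e; first by case: (inf n.+1).
by case: (inf n.+1) => //; apply/eqP; rewrite -invg_eq1 e.
Qed.

Definition centralizer g : set Gamma := [set u | commute g u].

Lemma centralizer_zpow g n : centralizer g `<=` centralizer (zpow g n).
Proof. by move=> u /commute_sym gu; apply/commute_sym/commute_zpow. Qed.

Lemma cyclic_id t : cyclic_subgroup t t.
Proof. by exists 1%R => //; rewrite zpow1. Qed.

Lemma cyclic_abelian t : is_abelian (cyclic_subgroup t).
Proof.
move=> _ _ [n _ <-] [m _ <-].
by apply/commute_zpow/commute_sym/commute_zpow; exact: commute_refl.
Qed.

Lemma sub_abelian (H K : set Gamma) :
  H `<=` K -> is_abelian K -> is_abelian H.
Proof. by move=> HK abK g h /HK Kg /HK; exact: abK. Qed.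

Lemma subgroup1 (H : set Gamma) : is_subgroup H -> H 1.
Proof. by case; rewrite inE. Qed.

Lemma subgroupM (H : set Gamma) g h : is_subgroup H -> H g -> H h -> H (g * h).
Proof.
by move=> /group_closedM HM Hg Hh; have := HM g h; rewrite !inE; apply.
Qed.

Lemma subgroupV (H : set Gamma) g : is_subgroup H -> H g -> H g^-1.
Proof. by move=> /group_closedV HV Hg; have := HV g; rewrite !inE; apply. Qed.

Lemma subgroup_zpow (H : set Gamma) g n : is_subgroup H -> H g -> H (zpow g n).
Proof.
move=> sH Hg.
have HX k : H (g ^+ k).
  by elim: k => [|k IH]; [exact: subgroup1 | rewrite expgS; exact: subgroupM].
by case: n => n //=; apply: subgroupV.
Qed.

Lemma additive_morph0 (V : zmodType) (phi : V -> Gamma) :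
  {morph phi : u v / (u + v)%R >-> u * v} -> phi 0%R = 1.
Proof.
by move=> phiD; apply: (@mulIg _ (phi 0%R)); rewrite -phiD GRing.add0r mul1g.
Qed.

Lemma additive_morph_zpow k (phi : 'rV[int]_k -> Gamma) :
  {morph phi : u v / (u + v)%R >-> u * v} ->
  forall x n, zpow (phi x) n = phi (n *: x)%R.
Proof.
move=> phiD x n; elim/int_rect: n => [|n IH|n IH].
- by rewrite GRing.scale0r (additive_morph0 phiD).
- have -> : (n.+1%:Z = n%:Z + 1)%R by lia.
  by rewrite zpowS IH -phiD GRing.scalerDl GRing.scale1r.
- have e : (- n%:Z = - n.+1%:Z + 1)%R by lia.
  move: IH; rewrite e zpowS GRing.scalerDl GRing.scale1r phiD; exact: mulIg.
Qed.

Lemma free_abelian_torsion_free k (H : set Gamma) g n :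
  free_abelian_of_rank k H -> H g -> zpow g n = 1 -> n <> 0%R -> g = 1.
Proof.
case=> phi [phiD phi_inj <-] [u _ <-].
rewrite (additive_morph_zpow phiD) -(additive_morph0 phiD) => /phi_inj nu n0.
congr phi; apply/rowP => s; have /rowP/(_ s) := nu; rewrite !mxE => /eqP.
by rewrite GRing.mulf_eq0 => /orP[/eqP|/eqP].
Qed.

(* The coefficients are the 2 x 2 minors, unless a and b are proportional. *)
Lemma rank2_relation (H : set Gamma) a b c :
  free_abelian_of_rank 2 H -> H a -> H b -> H c ->
  exists i j k : int, zpow a i * (zpow b j * zpow c k) = 1 /\
    [|| i != 0, j != 0 | k != 0]%R.
Proof.
case=> phi [phiD phi_inj <-] [u _ <-] [v _ <-] [w _ <-].
have phi0 := additive_morph0 phiD; have phiZ := additive_morph_zpow phiD.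
have relP i j k : (forall s : 'I_2,
    i * u ord0 s + (j * v ord0 s + k * w ord0 s) = 0)%R ->
    zpow (phi u) i * (zpow (phi v) j * zpow (phi w) k) = 1.
  move=> rel; rewrite !phiZ -!phiD -phi0; congr phi.
  by apply/rowP => s; rewrite !mxE; exact: rel.
pose x (y : 'rV[int]_2) := y ord0 ord0.
pose x' (y : 'rV[int]_2) := y ord0 ord_max.
have ord2 (P : 'I_2 -> Prop) : P ord0 -> P ord_max -> forall s, P s.
  move=> P0 P1 [[|[|s]] lt_s] //.
  - by have -> : Ordinal lt_s = ord0 by exact: val_inj.
  - by have -> : Ordinal lt_s = ord_max by exact: val_inj.
pose D := (x u * x' v - x' u * x v)%R.
case: (eqVneq D 0%R) => [D0|Dn0]; last first.
  exists (x v * x' w - x' v * x w)%R, (x w * x' u - x' w * x u)%R, D.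
  split; last by rewrite Dn0 !orbT.
  by apply: relP; apply: ord2; rewrite /D /x /x'; ring.
case: (eqVneq u 0%R) => [->|un0].
  exists 1%R, 0%R, 0%R; split=> //.
  by rewrite zpow1 phi0 !zpow0 !mul1g.
have [xu0|xun0] := eqVneq (x u) 0%R; last first.
  exists (x v), (- x u)%R, 0%R; split; last by rewrite GRing.oppr_eq0 xun0 orbT.
  apply: relP; apply: ord2; first by rewrite /x; ring.
  by transitivity (- D)%R; [rewrite /D /x /x'; ring | rewrite D0].
exists (x' v), (- x' u)%R, 0%R; split.
  apply: relP; apply: ord2; last by rewrite /x'; ring.
  by transitivity D; [rewrite /D /x /x'; ring | exact: D0].
rewrite GRing.oppr_eq0 orbA; apply/orP; left; apply/orP; right.
apply: contra un0 => /eqP x'u0; apply/eqP/rowP; apply: ord2; rewrite mxE //.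
Qed.

End Groups.

Lemma free_abelian_abelian (Gamma : groupType) n (H : set Gamma) :
  free_abelian_of_rank n H -> is_abelian H.
Proof.
case=> phi [phiD _ <-] _ _ [u _ <-] [v _ <-].
by rewrite /commute -!phiD GRing.addrC.
Qed.

(** * Distances and geodesics in the tree *)

Section Distance.
Variables (Gamma : groupType) (T : bipartite_tree Gamma).
Implicit Types (x y z : T) (p : seq T) (g : Gamma).

Definition walk x y (n : nat) : Prop :=
  exists p, [/\ path (@adj _ T) x p, last x p = y & size p = n].

Lemma adj_sym : symmetric (@adj _ T).
Proof. by case: (adj_tree T). Qed.

Lemma walk_exists x y : exists n, `[< walk x y n >].
Proof.
case: (adj_tree T) => _ _ _ conn _; have [p [px py]] := conn x y.
by exists (size p); apply/asboolP; exists p.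
Qed.

Definition dist x y : nat := ex_minn (walk_exists x y).

Lemma dist_walk x y : walk x y (dist x y).
Proof. by rewrite /dist; case: ex_minnP => n /asboolP. Qed.

Lemma dist_le x y n : walk x y n -> dist x y <= n.
Proof.
by move=> w; rewrite /dist; case: ex_minnP => m _; apply; apply/asboolP.
Qed.

Lemma ballE x r y : ball (@adj _ T) x r y <-> dist x y <= r.
Proof.
split=> [[p [px py pr]]|le_r].
  by apply: leq_trans pr; apply: dist_le; exists p.
by have [p [px py ps]] := dist_walk x y; exists p; rewrite ps.
Qed.

Lemma walkC x y n : walk x y n -> walk y x n.
Proof.
case=> p [px py ps]; exists (rev (belast x p)); split.
- rewrite -py rev_path; move: px; apply: sub_path => a b.
  by rewrite adj_sym.
- by case: p px py ps => //= a p _ _ _; rewrite rev_cons last_rcons.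
- by rewrite size_rev size_belast.
Qed.

Lemma distC x y : dist x y = dist y x.
Proof.
by apply/eqP; rewrite eqn_leq !dist_le//; apply/walkC; exact: dist_walk.
Qed.

Lemma dist_triangle y x z : dist x z <= dist x y + dist y z.
Proof.
have [p [px py ps]] := dist_walk x y; have [q [qx qy qs]] := dist_walk y z.
apply: dist_le; exists (p ++ q); split.
- by rewrite cat_path px py.
- by rewrite last_cat py.
- by rewrite size_cat ps qs.
Qed.

Lemma dist0 x : dist x x = 0.
Proof. by apply/eqP; rewrite -leqn0; apply: dist_le; exists [::]. Qed.

Lemma dist_eq0 x y : dist x y = 0 -> x = y.
Proof. by have [[|a p] [_ /= py ps]] := dist_walk x y; rewrite -ps. Qed.

Lemma dist_gt0 x y : x <> y -> 0 < dist x y.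
Proof. by case: (posnP (dist x y)) => // /dist_eq0. Qed.

Lemma dist_adj x y : adj x y -> dist x y <= 1.
Proof. by move=> xy; apply: dist_le; exists [:: y]; rewrite /= xy. Qed.

Lemma adj_white_addb x y : adj x y -> white y = ~~ white x.
Proof. by move=> /adj_white; case: (white x); case: (white y). Qed.

Lemma dist_parity x y : odd (dist x y) = white x (+) white y.
Proof.
have [p [px <- <-]] := dist_walk x y.
elim: p x px => [|z p IH] x /=; first by rewrite addbb.
by move=> /andP[/adj_white_addb wz /IH ->]; rewrite wz addNb negbK.
Qed.

Lemma dist_closer x z : x <> z ->
  exists y, adj x y /\ dist x z = (dist y z).+1.
Proof.
move=> xz; have [[|y p] [px py ps]] := dist_walk x z.
  by case: xz.
move: px py ps => /= /andP[xy yp] py ps.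
exists y; split=> //; apply/eqP; rewrite eqn_leq; apply/andP; split.
  by apply: leq_trans (dist_triangle y x z) _; move: (dist_adj xy); lia.
by rewrite -ps ltnS; apply: dist_le; exists p.
Qed.

Lemma dist1_adj x y : dist x y = 1%N -> adj x y.
Proof.
move=> d1; have [|z [xz]] := @dist_closer x y.
  by move=> e; move: d1; rewrite e dist0.
by rewrite d1 => -[/esym/dist_eq0 <-].
Qed.

(** The two distances differ by at most one, and their parities differ because the tree is
    bipartite. *)
Lemma dist_adj_cases x y z :
  adj x y -> dist x z = (dist y z).+1 \/ dist y z = (dist x z).+1.
Proof.
move=> xy; have wy := adj_white_addb xy.
have := dist_triangle y x z; have := dist_triangle x y z.
have := dist_adj xy; rewrite (distC y x).
have := dist_parity x z; have := dist_parity y z; rewrite wy addNb.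
by case: (white x (+) white z) => /=; lia.
Qed.

Lemma walk_through x y z p :
  path (@adj _ T) y p -> last y p = z -> x \in y :: p -> dist x z <= size p.
Proof.
move=> yp yz /splitPl sp; case: sp yp yz => p1 p2 e.
rewrite cat_path last_cat e => /andP[_ p2x] p2z; rewrite size_cat.
by apply: leq_trans (leq_addl _ _); apply: dist_le; exists p2.
Qed.

(* Two closer neighbours would be joined by a path avoiding x, closing up to a
   circuit through x. *)
Lemma dist_closer_unique x z y1 y2 : adj x y1 -> adj x y2 ->
  dist y1 z < dist x z -> dist y2 z < dist x z -> y1 = y2.
Proof.
move=> xy1 xy2 lt1 lt2; apply/eqP; apply: contraT => y12.
have [p1 [yp1 yz1 s1]] := dist_walk y1 z.
have [p2 [yp2 yz2 s2]] := dist_walk y2 z.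
have x1 : x \notin y1 :: p1.
  apply/negP => /(walk_through yp1 yz1); by rewrite s1 leqNgt lt1.
have x2 : x \notin y2 :: p2.
  apply/negP => /(walk_through yp2 yz2); by rewrite s2 leqNgt lt2.
pose p := p1 ++ rev (belast y2 p2).
have py : path (@adj _ T) y1 p.
  rewrite cat_path yp1 yz1 -yz2 rev_path; move: yp2; apply: sub_path => a b.
  by rewrite adj_sym.
have pl : last y1 p = y2.
  rewrite last_cat yz1; case: (p2) yz2 => //= a q _.
  by rewrite rev_cons last_rcons.
have xp : x \notin y1 :: p.
  rewrite -cat_cons mem_cat (negbTE x1) mem_rev /=.
  by apply: contra x2; exact: mem_belast.
case/shortenP: py pl => p' p'y p'u p'sub p'l.
case: (adj_tree T) => _ _ _ _ /(_ (x :: y1 :: p')) noc; case: noc.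
  by case: p' p'l {p'y p'u p'sub} => //= e; rewrite e eqxx in y12.
rewrite /ucycle /= xy1 rcons_path p'y p'l adj_sym xy2 /=.
move: p'u => /= ->; rewrite andbT.
move: xp; rewrite !inE !negb_or => /andP[-> /=].
by apply: contra => /p'sub.
Qed.

Lemma dist_farther x z y y' : adj x y -> adj x y' -> y <> y' ->
  dist y z < dist x z -> dist y' z = (dist x z).+1.
Proof.
move=> xy xy' yy' lt; case: (dist_adj_cases z xy') => // e.
by case: yy'; apply: (@dist_closer_unique x z) => //; rewrite e.
Qed.

(** The geodesics from [y] to [x] and to [z] start along different edges, so their union is a
    geodesic. The induction moves [y] one step towards [x]. *)
Lemma dist_concat y a b x z : adj y a -> adj y b -> a <> b ->
  dist a x < dist y x -> dist b z < dist y z ->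
  dist x z = (dist y x + dist y z)%N.
Proof.
have [n] := ubnP (dist y x); elim: n => // n IH in y a b *.
rewrite ltnS => le_n ya yb ab lta ltb.
have az : dist a z = (dist y z).+1.
  by apply: (dist_farther yb) => // /esym.
have ax : dist y x = (dist a x).+1.
  by case: (dist_adj_cases x ya) => // e; move: lta; rewrite e; lia.
case: (pselect (a = x)) => [e|/dist_closer[c [ac cx]]].
  by rewrite ax -e dist0 az.
rewrite (IH a c y) //; try lia.
- by rewrite adj_sym.
- by move=> e; move: cx; rewrite e; lia.
Qed.

Lemma dist_act g x y : dist (act g x) (act g y) = dist x y.
Proof.
have le h a b : dist (act h a) (act h b) <= dist a b.
  have [p [pa pb <-]] := dist_walk a b.
  apply: dist_le; exists (map (act h) p); split.
  - by rewrite path_map; move: pa; apply: sub_path => c d; rewrite /= act_adj.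
  - by rewrite last_map pb.
  - by rewrite size_map.
apply/eqP; rewrite eqn_leq le /=.
by move: (le g^-1 (act g x) (act g y)); rewrite -!actM !mulVg !act1.
Qed.

(** Without leaves, each vertex has a neighbour other than the one towards [y], so one can keep
    walking away from [y]. *)
Lemma dist_far (leafless_T : leafless T) k x y : x <> y ->
  exists2 z, dist x z <= k & dist z y = (dist x y + k)%N.
Proof.
elim: k x => [|k IH] x xy.
  by exists x; rewrite ?dist0 ?addn0.
have [a [xa da]] := dist_closer xy.
have [b xb /nesym ab] := leafless_T _ _ xa.
have db : dist b y = (dist x y).+1 by apply: (dist_farther xa xb); rewrite ?da.
have [|z dz dzy] := IH b; first by move=> e; move: db; rewrite e dist0.
exists z; last by rewrite dzy db; lia.
by move: (dist_triangle b x z) (dist_adj xb); lia.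
Qed.

End Distance.

(** * Stabilizers and fixed points *)

Section Stabilizers.
Variables (Gamma : groupType) (T : bipartite_tree Gamma).
Implicit Types (x y z v w : T) (g h t u : Gamma).

Lemma stab_subgroup x : is_subgroup (vertex_stab x).
Proof.
split; first by rewrite inE /= /vertex_stab /= act1.
move=> g h; rewrite !inE /= /vertex_stab /= => gx hx.
have h'x : act h^-1 x = x by rewrite -{1}hx -actM mulVg act1.
by rewrite actM h'x.
Qed.

Lemma stab_act g x :
  vertex_stab (act g x) = [set h | vertex_stab x (g^-1 * h * g)].
Proof.
apply/seteqP; split=> h; rewrite /vertex_stab /= !actM.
  by move=> ->; rewrite -actM mulVg act1.
by move=> /(congr1 (act g)); rewrite -!actM ?mulgA mulgV mul1g actM.
Qed.

Lemma fixed_centralizer g u x :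
  centralizer g u -> act g x = x -> act g (act u x) = act u x.
Proof. by move=> gu gx; rewrite -actM gu actM gx. Qed.

(** Convexity of fixed-point sets, from the uniqueness of the neighbour of [x] closer to [z]. *)
Lemma fixed_closer g x y z : adj x y -> dist y z < dist x z ->
  act g x = x -> act g z = z -> act g y = y.
Proof.
move=> xy lt gx gz; apply: (@dist_closer_unique _ _ x z) => //.
  by rewrite -{1}gx act_adj.
by rewrite -{1}gz dist_act.
Qed.

Lemma nontrivial_edge x y : x <> y ->
  exists v w, [/\ white v, ~~ white w & adj v w].
Proof.
move=> /dist_closer[a [xa _]]; have := adj_white_addb xa.
case: (boolP (white x)) => wx wa; first by exists x, a; rewrite wa.
by exists a, x; rewrite wa adj_sym.
Qed.

End Stabilizers.

(** * Generators at white vertices and their centralizers *)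

Section Suspension.
Variables (Gamma : groupType) (T : bipartite_tree Gamma).
Hypothesis leafless_T : leafless T.
Hypothesis susp_T : piecewise_trivial_suspension T.
Implicit Types (x y z v w : T) (g h t u : Gamma).

Lemma black_abelian w : ~~ white w -> is_abelian (vertex_stab w).
Proof. by case: susp_T => + _ _ => /[apply]; exact: free_abelian_abelian. Qed.

(** This collects what is needed of $t_v$, so that the complement $G_v$ is not mentioned again. *)
Definition suspension_generator v t : Prop :=
  [/\ infinite_order t,
      forall (n : int) x, n <> 0%R -> act (zpow t n) x = x <-> dist v x <= 2,
      forall n : int, n <> 0%R -> centralizer (zpow t n) = vertex_stab v,
      center (vertex_stab v) = cyclic_subgroup t
    & forall g, vertex_stab v g -> cyclic_subgroup g t ->
        centralizer g = vertex_stab v].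

Lemma suspension_generator_exists v :
  white v -> exists t, suspension_generator v t.
Proof.
case: susp_T => _ _ /[apply] -[G [t [[sG _ GtC Gt1 GtE] ZG inf fixt]]].
exists t.
have fixP (n : int) x : n <> 0%R -> act (zpow t n) x = x <-> dist v x <= 2.
  by move=> /fixt e; rewrite -ballE -e.
have stabC (n : int) : vertex_stab v `<=` centralizer (zpow t n).
  move=> g; rewrite -GtE => -[h Gh [k tk <-]].
  apply: commuteM; last by apply: (@cyclic_abelian _ t) => //; exists n.
  by apply/commute_sym/GtC => //; exists n.
(* An element commuting with a power of [t] preserves its fixed set, the ball of radius 2 around
   [v]; without leaves this ball determines its centre. *)
have CE (n : int) : n <> 0%R -> centralizer (zpow t n) = vertex_stab v.
  move=> n0; apply/seteqP; split; last exact: stabC.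
  move=> u tu; rewrite /vertex_stab /=; apply/esym.
  case: (pselect (v = act u v)) => // vuv.
  have [z zv zuv] := dist_far leafless_T 2 vuv.
  have tz : act (zpow t n) z = z by apply/fixP.
  have : act (zpow t n) (act u^-1 z) = act u^-1 z.
    by apply: fixed_centralizer => //; exact: commuteV.
  move=> /(fixP _ _ n0); rewrite -(dist_act u) -actM mulgV act1 distC zuv.
  by have := dist_gt0 vuv; lia.
split=> //.
- apply/seteqP; split=> [g []|_ [n _ <-]]; last first.
    split; last exact: stabC.
    rewrite -GtE; exists 1; first exact: subgroup1.
    by exists (zpow t n); [exists n | rewrite mul1g].
  move=> vg gC; move: (vg); rewrite -GtE => -[h Gh [k tk e]].
  (* The factor in [G] of a central element centralizes [G], so it is trivial. *)
  suff : center G h by rewrite ZG => h1; rewrite -e h1 mul1g.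
  split=> // h' Gh'.
  have -> : h = g * k^-1 by rewrite -e mulgK.
  apply: commute_sym; apply: commuteM.
    apply/commute_sym/gC; rewrite -GtE; exists h' => //.
    by exists 1; [exists 0%R | rewrite mulg1].
  by apply: commuteV; apply: GtC.
- move=> g vg [m _ gm]; move: (vg); rewrite -{1}GtE => -[h Gh [_ [j _ <-] e]].
  (* Here $g = h t^j$ and $g^m = t$, so $h^m$ lies in both factors and is trivial. Hence $jm = 1$,
     $m = \pm 1$ and $g = t^m$. *)
  have hm : zpow h m = zpow t (1 - j * m)%R.
    rewrite zpowD zpow1 -{1}gm -e zpow_mul; last by apply: GtC => //; exists j.
    by rewrite zpowM -mulgA -zpowD GRing.subrr zpow0 mulg1.
  have jm : (1 - j * m)%R = 0%R.
    apply: (zpow_eq1 inf); rewrite -hm.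
    have : (G `&` cyclic_subgroup t) (zpow h m).
      by split; [exact: subgroup_zpow | rewrite hm; exists (1 - j * m)%R].
    by rewrite Gt1.
  have mm : (m * m)%R = 1%R.
    have : (m %| 1)%Z by apply/dvdzP; exists j; lia.
    by rewrite dvdz1 => /eqP; nia.
  rewrite -(CE 1%R)// zpow1; apply/seteqP; split.
    by rewrite -gm; exact: centralizer_zpow.
  have -> : g = zpow t m by rewrite -gm zpowM mm zpow1.
  exact: centralizer_zpow.
Qed.

(** As [t2] is a power of [t1], it fixes the ball of radius 2 around [v1]. If the vertices differed,
    this ball would contain a point too far from [v2]. *)
Lemma generator_unique v1 v2 t1 t2 : suspension_generator v1 t1 ->
  suspension_generator v2 t2 -> cyclic_subgroup t1 t2 -> v1 = v2.
Proof.
case=> inf1 fix1 _ _ _ [inf2 fix2 _ _ _] [n _ e].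
have n0 : n <> 0%R.
  by move=> n0; apply: (inf2 1%N); rewrite // expg1 -e n0.
case: (pselect (v1 = v2)) => // v12.
have [z z1 z2] := dist_far leafless_T 2 v12.
have : dist v2 z <= 2.
  by apply/(fix2 1%R) => //; rewrite zpow1 -e; apply/fix1.
by rewrite distC z2; move: (dist_gt0 v12); lia.
Qed.

Lemma generator_fixes v t x :
  suspension_generator v t -> dist v x <= 2 -> act t x = x.
Proof. by case=> _ fixt _ _ _ d; rewrite -(zpow1 t); apply/fixt. Qed.

Lemma generator_centralizer v t :
  suspension_generator v t -> centralizer t = vertex_stab v.
Proof. by case=> _ _ /(_ 1%R) + _ _; rewrite zpow1; apply. Qed.

(** The generator at another white neighbour [v2] of [w] fixes [v]. Were the stabilizer abelian, it
    would be central there, hence a power of $t_v$, forcing [v2] to equal [v]. *)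
Lemma white_stab_nonabelian v w :
  white v -> adj v w -> ~ is_abelian (vertex_stab v).
Proof.
move=> wv vw ab.
have wv' : adj w v by rewrite adj_sym.
have [v2 wv2 v2v] := leafless_T wv'.
have wv2' : white v2 by rewrite (adj_white_addb wv2) (adj_white_addb vw) negbK.
have [t tP] := suspension_generator_exists wv.
have [t2 t2P] := suspension_generator_exists wv2'.
apply: v2v; apply/esym; apply: (generator_unique tP t2P).
case: (tP) => _ _ _ <- _.
have vt2 : vertex_stab v t2.
  apply: (generator_fixes t2P); rewrite distC.
  by move: (dist_triangle w v v2) (dist_adj vw) (dist_adj wv2); lia.
by split=> // h; exact: ab.
Qed.

(** The abelian stabilizer of [w] contains $t_v$, so it lies in the centralizer of $t_v$. *)
Lemma black_stab_sub w v :
  ~~ white w -> adj w v -> vertex_stab w `<=` vertex_stab v.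
Proof.
move=> bw wv g wg.
have [|t tP] := @suspension_generator_exists v.
  by rewrite (adj_white_addb wv).
rewrite -(generator_centralizer tP); apply: (black_abelian bw) => //.
by apply: (generator_fixes tP); rewrite distC; move: (dist_adj wv); lia.
Qed.

(** Take a white neighbour [z] of [w] away from [x]: its generator fixes [w], hence [x], so [x] is
    within 2 of [z] and within 1 of [w]. *)
Lemma black_stab_fixed w x : ~~ white w -> vertex_stab w `<=` vertex_stab x ->
  w = x \/ adj w x.
Proof.
move=> bw sub; case: (pselect (w = x)) => [|wx]; first by left.
right; have [z wz zx] := dist_far leafless_T 1 wx.
have zw : dist w z = 1%N.
  case: (posnP (dist w z)) => [/dist_eq0 e|]; last by lia.
  by move: zx; rewrite e; lia.
have [|t tP] := @suspension_generator_exists z.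
  by rewrite (adj_white_addb (dist1_adj zw)).
have : dist z x <= 2.
  case: (tP) => _ fixt _ _ _; apply/(fixt 1%R) => //; rewrite zpow1.
  by apply: sub; apply: (generator_fixes tP); rewrite distC zw.
rewrite zx => d; apply: dist1_adj; move: (dist_gt0 wx); lia.
Qed.

End Suspension.

(** * Recovering the tree from the subgroups of [Gamma] *)

Section Intrinsic.
Variables (Gamma : groupType) (T : bipartite_tree Gamma).
Hypothesis leafless_T : leafless T.
Hypothesis susp_T : piecewise_trivial_suspension T.
Implicit Types (x y z v w : T) (g h t u c : Gamma).

(* If c fixes a vertex at distance 2 from w beyond the white vertex v, then a
   relation between c, t_v and t_v1, with v1 another neighbour of w, must not
   involve t_v1, so that c and t_v are commensurable. *)
Lemma black_centralizer_fixed c w : c <> 1 -> ~~ white w -> act c w = w ->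
  exists y, centralizer c `<=` vertex_stab y.
Proof.
move=> c1 bw cw.
case: (pselect (exists x, act c x = x /\ 2 <= dist w x)); last first.
  (* The vertex [act u w] is fixed by [c] and has the colour of [w], so it is at even distance from
     [w]. *)
  move=> near; exists w => u cu; rewrite /vertex_stab /=.
  apply: contrapT => /nesym uw; apply: near.
  exists (act u w); split; first exact: fixed_centralizer.
  have := dist_gt0 uw; have := dist_parity w (act u w).
  by rewrite act_white addbb; case: (dist w (act u w)) => [|[]].
case=> x [cx wx2].
have wx : w <> x by move=> e; move: wx2; rewrite e dist0.
have [v [wv dv]] := dist_closer wx.
have cv : act c v = v by apply: (fixed_closer (z := x) wv) => //; rewrite dv.
have vx : v <> x by move=> e; move: wx2; rewrite dv e dist0.
have [x' [vx' dx']] := dist_closer vx.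
have cx' : act c x' = x'.
  by apply: (fixed_closer (z := x) vx') => //; rewrite dx'.
have x'w : w <> x' by move=> e; move: dv; rewrite dx' e; lia.
have vw : adj v w by rewrite adj_sym.
have wx' : dist w x' = 2.
  apply/eqP; rewrite (@dist_farther _ _ v x' x' w) ?dist0 //.
  - have := dist_adj vx'.
    case: (posnP (dist v x')) => [/dist_eq0 e|]; last by lia.
    by move: dx'; rewrite e; lia.
  - exact/nesym.
  - by case: (posnP (dist v x')) => [/dist_eq0 e|//]; move: dx'; rewrite e; lia.
have [v1 wv1 v1v] := leafless_T wv.
have v1x' : dist v1 x' = 3.
  rewrite (dist_farther wv wv1) ?wx' //; first exact/nesym.
  by have := dist_adj vx'; lia.
have whitev : white v by rewrite (adj_white_addb wv).
have whitev1 : white v1 by rewrite (adj_white_addb wv1).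
have [t tP] := suspension_generator_exists leafless_T susp_T whitev.
have [t1 t1P] := suspension_generator_exists leafless_T susp_T whitev1.
have fre : free_abelian_of_rank 2 (vertex_stab w) by case: susp_T => /(_ _ bw).
have tw : act t w = w by apply: (generator_fixes tP); have := dist_adj vw; lia.
have t1w : act t1 w = w.
  by apply: (generator_fixes t1P); rewrite distC; have := dist_adj wv1; lia.
have tx' : act t x' = x'.
  by apply: (generator_fixes tP); have := dist_adj vx'; lia.
have [k [i [j [rel nz]]]] := rank2_relation fre cw tw t1w.
(* Both [c] and [t] fix [x'], so the relation makes [zpow t1 j] fix it too; but [x'] is at distance
   3 from [v1]. *)
have j0 : j = 0%R.
  apply: contrapT => j0; case: (t1P) => _ fix1 _ _ _.
  suff : dist v1 x' <= 2 by rewrite v1x'.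
  apply/(fix1 _ _ j0).
  have [cx'' tx''] : act (zpow c k) x' = x' /\ act (zpow t i) x' = x'.
    by split; apply: (subgroup_zpow _ (stab_subgroup x')).
  have := congr1 (fun g => act g x') rel; rewrite !actM act1 => e.
  have e1 : act (zpow t i) (act (zpow t1 j) x') = x'.
    have inj a b : act (zpow c k) a = act (zpow c k) b -> a = b.
      by move=> /(congr1 (act (zpow c k)^-1)); rewrite -!actM mulVg !act1.
    by apply: inj; rewrite e cx''.
  have inj a b : act (zpow t i) a = act (zpow t i) b -> a = b.
    by move=> /(congr1 (act (zpow t i)^-1)); rewrite -!actM mulVg !act1.
  by apply: inj; rewrite e1 tx''.
move: rel nz; rewrite j0 zpow0 mulg1 eqxx orbF => rel.
case: (eqVneq i 0%R) => [i0|/eqP i0 _].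
  move: rel; rewrite i0 zpow0 mulg1 orbF => ck /eqP k0.
  by case: c1; exact: (free_abelian_torsion_free fre cw ck k0).
exists v => u cu; case: (tP) => _ _ /(_ _ i0) <- _ _.
have -> : zpow t i = (zpow c k)^-1.
  by apply: (@mulgI _ (zpow c k)); rewrite rel mulgV.
apply/commute_sym/commuteV/commute_sym; exact: centralizer_zpow.
Qed.

(* An element without fixed point translates the set M of vertices of minimal
   displacement along the map s sending y to the next vertex towards g y; as s
   is canonical, it commutes with the centralizer of g, which acts on M through
   powers of s. Hence commutators fix an edge. *)
Lemma hyperbolic_centralizer_abelian g :
  (forall x, act g x <> x) -> is_abelian (centralizer g).
Proof.
move=> nofix.
have nofix' x : x <> act g x by exact/nesym.
have /choice[s sP] y : exists z, adj y z /\
    dist y (act g y) = (dist z (act g y)).+1 by exact: dist_closer.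
have s_unique y z : adj y z -> dist z (act g y) < dist y (act g y) -> z = s y.
  move=> yz lt; have [ys ds] := sP y.
  by apply: (dist_closer_unique yz ys lt); rewrite ds.
have sC u y : centralizer g u -> s (act u y) = act u (s y).
  move=> gu; have [ys ds] := sP y; apply/esym/s_unique; rewrite ?act_adj//.
  by rewrite -actM gu actM !dist_act ds.
pose M y := forall z, dist y (act g y) <= dist z (act g z).
have Ms y : M y -> M (s y).
  move=> My z; apply: leq_trans (My z); have [ys ds] := sP y.
  have := dist_triangle (act g y) (s y) (act g (s y)); rewrite dist_act.
  by have := dist_adj ys; lia.
have MX n y : M y -> M (iter n s y) by move=> My; elim: n => //= n; exact: Ms.
have Mu u y : centralizer g u -> M y -> M (act u y).
  by move=> gu My z; rewrite -actM gu actM dist_act.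
have s_inj y1 y2 : M y1 -> M y2 -> s y1 = s y2 -> y1 = y2.
  move=> M1 M2 e.
  (* On [M], the vertex [y] is the neighbour of [s y] towards $g^{-1}(s\,y)$, so [s y] determines
     it. *)
  have lt y : M y -> dist y (act g^-1 (s y)) < dist (s y) (act g^-1 (s y)).
    move=> My; rewrite -(dist_act g y) -(dist_act g (s y)) -!actM mulgV act1.
    have := Ms _ My y; have := My (s y); have [ys ds] := sP y.
    by rewrite (distC (act g y)) (distC (act g (s y))); lia.
  apply: (@dist_closer_unique _ _ (s y1) (act g^-1 (s y1))).
  - by rewrite adj_sym; case: (sP y1).
  - by rewrite adj_sym e; case: (sP y2).
  - exact: lt.
  - by rewrite e; exact: lt.
have iter_inj n y1 y2 : M y1 -> M y2 -> iter n s y1 = iter n s y2 -> y1 = y2.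
  move=> M1 M2; elim: n => //= n IH /s_inj e; apply: IH.
  by apply: e; exact: MX.
have orbit y y' : M y -> M y' -> exists n m, iter n s y = iter m s y'.
  have [k] := ubnP (dist y y'); elim: k => // k IH in y y' *.
  rewrite ltnS => le_k My My'.
  case: (pselect (y = y')) => [<-|yy']; first by exists 0, 0.
  have [a [ya da]] := dist_closer yy'.
  case: (pselect (a = s y)) => [ay|ay].
    have [|n [m e]] := IH (s y) y' _ (Ms _ My) My'; first by rewrite -ay; lia.
    by exists n.+1, m; rewrite iterSr.
  have [b [yb]] := dist_closer (nesym yy'); rewrite distC => db.
  case: (pselect (b = s y')) => [by'|by'].
    have [|n [m e]] := IH y (s y') _ My (Ms _ My').
      by rewrite -by' distC; lia.
    by exists n, m.+1; rewrite iterSr.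
  (* If [s] brings neither vertex nearer to the other, the geodesic from [y'] to $gy$ passes through
     [y], and the one from $gy'$ to $gy$ through [y']; the latter is then longer than the distance
     from [y'] to [y], which [g] preserves. *)
  have [ys ds] := sP y; have [ys' ds'] := sP y'.
  have e1 : dist (act g y) y' = (dist y (act g y) + dist y y')%N.
    by apply: (dist_concat ys ya); rewrite ?ds ?da //; exact/nesym.
  have e2 : dist (act g y') (act g y) =
      (dist y' (act g y') + dist y' (act g y))%N.
    apply: (dist_concat ys' yb); rewrite ?ds' //; first exact/nesym.
    have := dist_triangle y b (act g y); rewrite (distC y' (act g y)) e1; lia.
  move: e2; rewrite dist_act (distC y' y) (distC y' (act g y)) e1.
  by have := dist_gt0 (nofix' y); lia.
have iterC n u y : centralizer g u -> act u (iter n s y) = iter n s (act u y).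
  by move=> gu; elim: n => //= n <-; rewrite sC.
have [y0 My0] : exists y, M y.
  have ex : exists n, `[< exists y, dist y (act g y) = n >].
    case: (adj_tree T) => -[x] _ _ _ _; exists (dist x (act g x)).
    by apply/asboolP; exists x.
  case: (ex_minnP ex) => n /asboolP[y yn] min; exists y => z.
  by rewrite yn; apply: min; apply/asboolP; exists z.
have comm u u' y : centralizer g u -> centralizer g u' -> M y ->
    act (u * u') y = act (u' * u) y.
  move=> gu gu' My.
  have [n [m e]] := orbit _ _ (Mu _ _ gu My) My.
  have [n' [m' e']] := orbit _ _ (Mu _ _ gu' My) My.
  (* On [y], [u] acts as $s^{m-n}$ and [u'] as $s^{m'-n'}$; after $n+n'$ further steps both products
     reach $s^{m+m'}y$. *)
  rewrite !actM; apply: (iter_inj (n + n')%N); [exact/Mu/Mu | exact/Mu/Mu |].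
  transitivity (iter (m + m') s y).
    rewrite (iterD n) -iterC// e' iterC// -iterD (addnC n) (iterD m') e.
    by rewrite -iterD addnC.
  rewrite (addnC n) (iterD n') -iterC// e iterC// -iterD (addnC n').
  by rewrite (iterD m n') e' -iterD.
move=> u u' gu gu'; pose c := (u' * u)^-1 * (u * u').
have gc : centralizer g c.
  by apply: commuteM; [apply: commuteV|]; apply: commuteM.
have fixc y : M y -> act c y = y.
  by move=> My; rewrite /c actM comm// -actM mulVg act1.
case: (pselect (c = 1)) => [c1|c1].
  by apply/esym; apply: (@mulgI _ (u' * u)^-1); rewrite -/(c) c1 mulVg.
(* The element [c] fixes the adjacent vertices [y0] and [s y0], one of which is black. Since [g]
   centralizes [c], it would fix a vertex as well. *)
have [y yP] : exists y, centralizer c `<=` vertex_stab y.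
  have [ys _] := sP y0.
  case: (boolP (white y0)) => wy; last first.
    exact: (black_centralizer_fixed c1 wy (fixc _ My0)).
  apply: (black_centralizer_fixed c1 _ (fixc _ (Ms _ My0))).
  by rewrite (adj_white_addb ys) wy.
by case: (nofix y); apply: yP; apply: commute_sym.
Qed.

Definition white_group (H : set Gamma) : Prop :=
  exists g, [/\ g <> 1, ~ is_abelian (centralizer g),
    center (centralizer g) = cyclic_subgroup g & H = centralizer g].

(** The inclusion of the centre of [K1] in [K2] expresses that the two white vertices are at
    distance at most 2. *)
Definition black_group (H : set Gamma) : Prop :=
  exists K1 K2, [/\ white_group K1, white_group K2, K1 <> K2,
    center K1 `<=` K2 & H = K1 `&` K2].

Lemma white_group_stab H :
  white_group H -> exists2 v : T, white v & vertex_stab v = H.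
Proof.
case=> g [g1 nab ZC ->].
have [y yP] : exists y, centralizer g `<=` vertex_stab y.
  case: (pselect (forall x, act g x <> x)) => [nofix|].
    by case: nab; exact: (hyperbolic_centralizer_abelian nofix).
  move=> /existsNP[x /contrapT gx].
  case: (pselect (exists w, ~~ white w /\ act g w = w)) => [[w [bw gw]]|nob].
    exact: (black_centralizer_fixed g1 bw gw).
  (* All fixed vertices being white, no two are adjacent; by convexity [x] is the only one, so the
     centralizer of [g] fixes it. *)
  have fixw z : act g z = z -> white z.
    by move=> gz; apply: contrapT => /negP wz; apply: nob; exists z.
  exists x => u gu; rewrite /vertex_stab /=; apply: contrapT => /nesym xu.
  have [a [xa da]] := dist_closer xu.
  have ga : act g a = a.
    by apply: (fixed_closer xa _ gx (fixed_centralizer gu gx)); rewrite da.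
  by have := fixw _ ga; rewrite (adj_white_addb xa) fixw.
have wy : white y.
  apply: contrapT => /negP by'; apply: nab.
  exact: sub_abelian yP (black_abelian susp_T by').
exists y => //.
have [t tP] := suspension_generator_exists leafless_T susp_T wy.
have gy : vertex_stab y g by apply: yP; exact: commute_refl.
have Ct := generator_centralizer tP.
(* As the centralizer of [g] fixes [y], it centralizes [t]; so [t] is in its centre and is a power
   of [g]. *)
case: (tP) => _ _ _ _ -> //; rewrite -ZC; split.
  by apply: commute_sym; change (centralizer t g); rewrite Ct.
by move=> h /yP; rewrite -Ct.
Qed.

Hypothesis nonabelian_Gamma : ~ is_abelian [set: Gamma].

(** A vertex without neighbours is the whole tree, and its stabilizer is then [Gamma]. *)
Lemma vertex_neighbour x : is_abelian (vertex_stab x) -> exists y, adj x y.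
Proof.
move=> abx; apply: contrapT => noy; apply: nonabelian_Gamma.
apply: (sub_abelian _ abx) => g _; rewrite /vertex_stab /=.
apply: contrapT => /nesym /dist_closer[y [xy _]]; apply: noy; by exists y.
Qed.

Lemma abelian_stabP x : is_abelian (vertex_stab x) <-> ~~ white x.
Proof.
split=> [abx|]; last exact: black_abelian.
have [y xy] := vertex_neighbour abx.
apply/negP => wx; exact: (white_stab_nonabelian leafless_T susp_T wx xy).
Qed.

Lemma white_stab_group v : white v -> white_group (vertex_stab v).
Proof.
move=> wv; have [t tP] := suspension_generator_exists leafless_T susp_T wv.
exists t; rewrite (generator_centralizer tP); split=> //.
- by case: tP => /(_ 1%N isT) + _ _ _ _; rewrite expg1.
- by rewrite abelian_stabP wv.
- by case: tP.
Qed.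

(** White vertices are separated by the centres of their stabilizers; two distinct black ones would
    have to be adjacent. *)
Lemma stab_inj x y : vertex_stab x = vertex_stab y -> x = y.
Proof.
move=> e; case: (boolP (white x)) => wx.
  have wy : white y.
    by apply: contraT; rewrite -abelian_stabP -e abelian_stabP wx.
  have [t tP] := suspension_generator_exists leafless_T susp_T wx.
  have [t' t'P] := suspension_generator_exists leafless_T susp_T wy.
  apply: (generator_unique leafless_T tP t'P).
  case: (tP) => _ _ _ <- _; rewrite e; case: (t'P) => _ _ _ -> _.
  exact: cyclic_id.
have wy : ~~ white y by rewrite -abelian_stabP -e abelian_stabP.
have [//|/adj_white_addb] : x = y \/ adj x y.
  by apply: (black_stab_fixed leafless_T susp_T wx); rewrite e.
by rewrite (negbTE wx) (negbTE wy).
Qed.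

Lemma stab_middle v1 v2 w : ~~ white w -> adj w v1 -> adj w v2 -> v1 <> v2 ->
  vertex_stab w = vertex_stab v1 `&` vertex_stab v2.
Proof.
move=> bw wv1 wv2 v12; apply/seteqP; split=> [g gw|g [g1 g2]].
  by split; exact: (black_stab_sub leafless_T susp_T bw _ gw).
have d2 := dist_adj wv2.
apply: (@fixed_closer _ _ g v1 w v2) => //; first by rewrite adj_sym.
case: (dist_adj_cases v2 wv1) => [e|->//].
have d0 := dist_gt0 v12; lia.
Qed.

Lemma white_dist_gt1 v1 v2 :
  white v1 -> white v2 -> v1 <> v2 -> 2 <= dist v1 v2.
Proof.
move=> w1 w2 /dist_gt0; have := dist_parity v1 v2; rewrite w1 w2.
by case: (dist v1 v2) => [|[]].
Qed.

Lemma black_stab_group w : ~~ white w -> black_group (vertex_stab w).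
Proof.
move=> bw; have [v1 wv1] := vertex_neighbour (black_abelian susp_T bw).
have [v2 wv2 v21] := leafless_T wv1.
have w1 : white v1 by rewrite (adj_white_addb wv1).
have w2 : white v2 by rewrite (adj_white_addb wv2).
exists (vertex_stab v1), (vertex_stab v2); split.
- exact: white_stab_group.
- exact: white_stab_group.
- by move=> /stab_inj/esym.
- have [t tP] := suspension_generator_exists leafless_T susp_T w1.
  case: (tP) => _ _ _ -> _ _ [n _ <-].
  apply: (subgroup_zpow _ (stab_subgroup v2)); apply: (generator_fixes tP).
  have := dist_triangle w v1 v2; rewrite (distC v1 w).
  by have := dist_adj wv1; have := dist_adj wv2; lia.
- by apply: stab_middle => //; exact/nesym.
Qed.

Lemma black_group_stab H :
  black_group H -> exists2 w : T, ~~ white w & vertex_stab w = H.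
Proof.
case=> _ [_ [/white_group_stab[v1 w1 <-] /white_group_stab[v2 w2 <-]]].
move=> v12 sub ->.
have {}v12 : v1 <> v2 by move=> e; apply: v12; rewrite e.
have [t tP] := suspension_generator_exists leafless_T susp_T w1.
have d2 : dist v1 v2 <= 2.
  case: (tP) => _ fixt _ ZE _; apply/(fixt 1%R) => //; rewrite zpow1.
  by apply: sub; rewrite ZE; exact: cyclic_id.
have [w [v1w dw]] := dist_closer v12.
have bw : ~~ white w by rewrite (adj_white_addb v1w) w1.
exists w => //; apply: stab_middle => //; first by rewrite adj_sym.
by apply: dist1_adj; have := white_dist_gt1 w1 w2 v12; lia.
Qed.

(** The right-hand side involves only subgroups of [Gamma], so it carries over from one tree to the
    other. *)
Lemma stab_adj x y : adj x y <->
  (~ is_abelian (vertex_stab x) /\ vertex_stab y `<=` vertex_stab x /\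
     is_abelian (vertex_stab y)) \/
  (~ is_abelian (vertex_stab y) /\ vertex_stab x `<=` vertex_stab y /\
     is_abelian (vertex_stab x)).
Proof.
have bw v w : white v -> ~~ white w ->
    adj w v <-> vertex_stab w `<=` vertex_stab v.
  move=> wv bw; split; first exact: black_stab_sub.
  by move=> /(black_stab_fixed leafless_T susp_T bw)[e|//]; rewrite e wv in bw.
rewrite !abelian_stabP; split.
  move=> xy; have wy := adj_white_addb xy.
  case: (boolP (white x)) => wx; [left|right]; rewrite ?wy ?wx.
    split=> //; split=> //; apply/bw; rewrite ?wy ?wx // adj_sym //.
  by split=> //; split=> //; apply/bw; rewrite ?wy ?wx.
case=> [[/negP]|[/negP]]; rewrite negbK => wv [sub bw'].
  by rewrite adj_sym; apply/bw.
exact/bw.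
Qed.

End Intrinsic.

(** * Comparison of the two trees *)

Lemma exists_same_stab (Gamma : groupType) (T T' : bipartite_tree Gamma) :
  leafless T -> leafless T' -> piecewise_trivial_suspension T ->
  piecewise_trivial_suspension T' -> ~ is_abelian [set: Gamma] ->
  forall x : T, exists x' : T', vertex_stab x' = vertex_stab x.
Proof.
move=> lT lT' sT sT' nab x; case: (boolP (white x)) => wx.
  have [x' _ e] := white_group_stab lT' sT' (white_stab_group lT sT nab wx).
  by exists x'.
have [x' _ e] := black_group_stab lT' sT' (black_stab_group lT sT nab wx).
by exists x'.
Qed.

Lemma abelian_one_vertex (Gamma : groupType) (T : bipartite_tree Gamma) :
  leafless T -> piecewise_trivial_suspension T -> is_abelian [set: Gamma] ->
  forall x y : T, x = y.
Proof.
move=> lT sT ab x y; apply: contrapT => /nontrivial_edge[v [w [wv _ vw]]].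
apply: (white_stab_nonabelian lT sT wv vw); exact: sub_abelian ab.
Qed.

Theorem proposition3p5 (Gamma : groupType) (T T' : bipartite_tree Gamma)
    (leafless_T : leafless T) (leafless_T' : leafless T')
    (susp_T : piecewise_trivial_suspension T)
    (susp_T' : piecewise_trivial_suspension T') :
  exists f : T -> T', is_Gamma_tree_isomorphism f.
Proof.
case: (pselect (is_abelian [set: Gamma])) => [ab|nab].
  have one := abelian_one_vertex leafless_T susp_T ab.
  have one' := abelian_one_vertex leafless_T' susp_T' ab.
  case: (adj_tree T) (adj_tree T') => -[x0] _ irr _ _ [[x0'] _ irr' _ _].
  exists (fun=> x0'); split=> //; first by exists (fun=> x0).
  by move=> x y; rewrite (one x y) irr irr'.
have /choice[f fP] :=
  exists_same_stab leafless_T leafless_T' susp_T susp_T' nab.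
have /choice[f' f'P] :=
  exists_same_stab leafless_T' leafless_T susp_T' susp_T nab.
have inj := stab_inj leafless_T susp_T nab.
have inj' := stab_inj leafless_T' susp_T' nab.
exists f; split.
- by exists f' => x; [apply: inj | apply: inj']; rewrite ?(f'P, fP).
- move=> x y; apply/idP/idP => /stab_adj; rewrite ?fP => H;
  apply/stab_adj => //; by rewrite ?fP; apply: H.
(* Equivariance holds because translating a vertex by [g] conjugates its stabilizer by [g] in either
   tree. *)
- by move=> g x; apply: inj'; rewrite fP !stab_act fP.
Qed.
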